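(* For every positive integer $N$ there exist graphs $G$ and $H$ such that $H$ is a supergraph of $G$ and $F(G)-F(H)\geq N$. That is, $F(G)-F(H)$ can be made arbitrarily large over pairs of a graph $G$ and a supergraph $H$ of $G$.
   Context: All graphs are finite and simple. $H$ is a supergraph of $G$ if $V(G)\subseteq V(H)$ and $E(G)\subseteq E(H)$. Given a graph $G$ and a set $S\subseteq V(G)$, the forcing rule is: if a vertex $v\in S$ has exactly one neighbor $u$ not in $S$, then $u$ is added to $S$. A set $S$ is a failed zero-forcing set of $G$ if repeated application of the forcing rule starting from $S$ does not result in all vertices of $G$ being in $S$. The failed zero-forcing number $F(G)$ is the maximum cardinality of a failed zero-forcing set of $G$. *)

(* Defs.v *)
From mathcomp Require Import all_boot all_order all_algebra.
Set Implicit Arguments.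
Unset Strict Implicit.
Unset Printing Implicit Defensive.

(* A finite simple graph whose vertices form a subset of an ambient finite
   type, so that inclusion of vertex and edge sets between two graphs is
   literal inclusion; points of T outside vset are not part of the graph. *)
Record sgraph (T : finType) := SGraph {
  vset : {set T};
  adj : rel T;
  adj_vset : forall x y, adj x y -> (x \in vset) && (y \in vset);
  adj_sym : symmetric adj;
  adj_irr : irreflexive adj
}.

Definition supergraph (T : finType) (H G : sgraph T) : Prop :=
  vset G \subset vset H /\ subrel (adj G) (adj H).

Definition nbhd (T : finType) (G : sgraph T) (v : T) : {set T} :=
  [set u | adj G v u].

Definition force_step (T : finType) (G : sgraph T) : rel {set T} :=
  fun S S' =>
    [exists v in S, exists u, (nbhd G v :\: S == [set u]) && (S' == u |: S)].

(* The order of the forces does not matter: a force available at S stays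
   available, or has already been performed, at any larger set.  Hence repeated
   application of the rule ends at the whole vertex set iff some sequence of
   forces reaches it. *)
Definition zero_forcing (T : finType) (G : sgraph T) (S : {set T}) : bool :=
  connect (force_step G) S (vset G).

Definition failed (T : finType) (G : sgraph T) (S : {set T}) : bool :=
  (S \subset vset G) && ~~ zero_forcing G S.

(* If vset G is nonempty, set0 is failed, so this is a maximum over a nonempty
   family; it takes the conventional value 0 for the graph with no vertex. *)
Definition failed_zf_number (T : finType) (G : sgraph T) : nat :=
  \max_(S : {set T} | failed G S) #|S|.

(* Main.v *)
Require Import Defs.
From mathcomp Require Import all_boot all_order all_algebra.
From mathcomp Require Import zify.
Set Implicit Arguments.
Unset Strict Implicit.
Unset Printing Implicit Defensive.
Import Order.TTheory GRing.Theory Num.Theory.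
Local Open Scope ring_scope.

(** Take for G the edgeless graph and for H the path, both on 2m vertices. In
    G nothing is ever forced, so the complement of a vertex is failed and
    F(G) >= 2m - 1. In H two consecutive vertices force all the others, so a
    failed set contains at most one vertex of each pair {2k, 2k + 1}, and
    F(H) <= m. *)

(** A force always adds a vertex outside [S], so these are exactly the sets closed under the forcing
    rule. *)
Definition stalled (T : finType) (G : sgraph T) (S : {set T}) : Prop :=
  forall S', ~~ force_step G S S'.

Lemma stalled_closed (T : finType) (G : sgraph T) (S : {set T}) (v x : T) :
  stalled G S -> v \in S -> adj G v x ->
  (forall y, adj G v y -> y != x -> y \in S) -> x \in S.
Proof.
move=> stS vS vx others; apply/negPn/negP => xS.
have /negP := stS (x |: S); apply.
apply/existsP; exists v; rewrite vS; apply/existsP; exists x.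
rewrite eqxx andbT; apply/eqP/setP => y; rewrite !inE.
have [-> | yx] := eqVneq y x; first by rewrite xS.
by apply/negbTE; rewrite andbC; apply/negP => /andP[/others -> //].
Qed.

Lemma force_step_vset (T : finType) (G : sgraph T) (S S' : {set T}) :
  force_step G S S' -> S \subset vset G ->
  S \proper S' /\ S' \subset vset G.
Proof.
case/existsP => v /andP[_ /existsP[u /andP[/eqP Nu /eqP ->]]] sSV.
have: u \in nbhd G v :\: S by rewrite Nu set11.
rewrite !inE => /andP[uS /adj_vset/andP[_ uV]].
split; last by rewrite subUset sub1set uV.
by rewrite properE subsetUr subUset sub1set (negbTE uS).
Qed.

(** Force for as long as possible: each force shrinks the complement, so this ends, and it cannot
    end at [vset G] because [S] is failed. *)
Lemma failed_stalled (T : finType) (G : sgraph T) (S : {set T}) :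
  failed G S ->
  exists S' : {set T}, [/\ S \subset S', S' \proper vset G & stalled G S'].
Proof.
have [n] := ubnP #|~: S|; elim: n S => // n IHn S ltSn /andP[sSV nzS].
have [S' stepS | noStep] := pickP (force_step G S); last first.
  exists S; split=> // [|S']; last by rewrite noStep.
  rewrite properEneq sSV andbT; apply: contraNneq nzS => ->.
  exact: connect0.
have [pSS' sS'V] := force_step_vset stepS sSV.
have [||S2 [sS'S2 pS2 st2]] := IHn S'.
- by have : (#|~: S'| < #|~: S|)%N; [rewrite proper_card ?properC | lia].
- by rewrite /failed sS'V; apply: contra nzS; apply: connect_trans; apply: connect1.
by exists S2; split=> //; apply: subset_trans (proper_sub pSS') sS'S2.
Qed.

Definition edgeless (T : finType) : sgraph T.
Proof. by exists [set: T] (fun _ _ => false). Defined.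

Definition path_graph (n : nat) : sgraph 'I_n.
Proof.
exists [set: 'I_n]
  (fun i j : 'I_n => (i.+1 == j :> nat) || (j.+1 == i :> nat)).
- by move=> i j _; rewrite !inE.
- by move=> i j; rewrite orbC.
- by move=> i; apply/negbTE; lia.
Defined.

Lemma failed_zf_number_edgeless (T : finType) :
  (#|T|.-1 <= failed_zf_number (edgeless T))%N.
Proof.
have [x _ | T0] := pickP (fun _ : T => true); last by rewrite eq_card0.
rewrite -(cardsC1 x); apply: leq_bigmax_cond.
(* An empty sequence of forces would put [x] in its own complement; a nonempty one starts by forcing
   a vertex of an empty neighbourhood. *)
rewrite /failed subsetT; apply/negP => /connectP[[|S p] /=].
  by move=> _ /setP/(_ x); rewrite !inE eqxx.
case/andP => /existsP[v /andP[_ /existsP[u /andP[/eqP/setP/(_ u)]]]].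
by rewrite !inE eqxx andbF.
Qed.

Lemma path_graph_stalled n (S : {set 'I_n}) (i j : 'I_n) :
  stalled (path_graph n) S -> i \in S -> j \in S -> i.+1 = j ->
  S = [set: 'I_n].
Proof.
move=> stS iS jS ij.
(* The consecutive pair is pushed to the right: the only other neighbour of [i + k + 1] is [i + k],
   already in [S]. Quantifying over [x] makes the claim vacuous past the end of the path. *)
have up k : (forall x : 'I_n, x = (i + k)%N :> nat -> x \in S) /\
            (forall x : 'I_n, x = (i + k).+1 :> nat -> x \in S).
  elim: k => [|k [IH0 IH1]].
    by split=> x xE; [rewrite (_ : x = i) | rewrite (_ : x = j)] => //;
       apply: val_inj => /=; lia.
  split=> x xE; first by apply: IH1; lia.
  have vn : ((i + k).+1 < n)%N by have := ltn_ord x; lia.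
  apply: (stalled_closed (v := Ordinal vn) stS) => /=.
  - exact: IH1.
  - by lia.
  - by move=> y /= vy yx; apply: IH0; move: vy yx; rewrite -val_eqE /=; lia.
(* Symmetric push to the left; [k <= i] keeps the subtraction from truncating. *)
have down k : (k <= i)%N ->
    (forall x : 'I_n, x = (i - k)%N :> nat -> x \in S) /\
    (forall x : 'I_n, x = (i - k).+1 :> nat -> x \in S).
  elim: k => [_|k IHk ki].
    by have := up 0%N; rewrite addn0 subn0.
  have [|IH0 IH1] := IHk; first by lia.
  split=> x xE; last by apply: IH0; lia.
  have vn : (i - k < n)%N by have := ltn_ord i; lia.
  apply: (stalled_closed (v := Ordinal vn) stS) => /=.
  - exact: IH0.
  - by lia.
  - by move=> y /= vy yx; apply: IH1; move: vy yx; rewrite -val_eqE /=; lia.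
apply/setP => x; rewrite inE.
have [xi | ix] := leqP x i.
  by have [|+ _] := down (i - x)%N; [lia | apply; lia].
by have [+ _] := up (x - i)%N; apply; lia.
Qed.

Lemma failed_zf_number_path m :
  (failed_zf_number (path_graph m.*2) <= m)%N.
Proof.
apply/bigmax_leqP => S /failed_stalled[S' [sSS' pS' stS']].
apply: leq_trans (subset_leq_card sSS') _.
have half_lt (i : 'I_m.*2) : (i./2 < m)%N by have := ltn_ord i; lia.
(* Halving is injective on [S']: distinct indices with equal halves are consecutive, and two
   consecutive members would make [S'] the whole path. *)
rewrite -[leqRHS]card_ord -(card_in_imset (f := fun i => Ordinal (half_lt i))).
  exact: max_card.
have no_succ (i j : 'I_m.*2) : i \in S' -> j \in S' -> i.+1 <> j.
  move=> iS jS ij; move: pS'.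
  by rewrite (path_graph_stalled stS' iS jS ij) properxx.
move=> i j iS jS [ij]; apply: val_inj => /=.
by have := no_succ _ _ iS jS; have := no_succ _ _ jS iS; lia.
Qed.

Theorem theorem2p2 (N : nat) (hN : (0 < N)%N) :
  exists (T : finType) (G H : sgraph T),
    supergraph H G /\
    (failed_zf_number G)%:Z - (failed_zf_number H)%:Z >= N%:Z.
Proof.
(* With [m = N + 1] the bounds give a difference of at least [(2m - 1) - m = N]. *)
exists 'I_(N.+1).*2, (edgeless _), (path_graph _); split.
  by split; first exact: subsetT.
have := failed_zf_number_edgeless 'I_(N.+1).*2.
have := failed_zf_number_path N.+1.
by rewrite card_ord; lia.
Qed.
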